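(* Let $N$ be a unitarily invariant norm on $M_n(\mathbb{C})$, let $A\in M_n(\mathbb{C})$ be positive definite and let $X\in M_n(\mathbb{C})$. Then the function $$k(t)=w_N\big(A^{t}XA^{1-t}+A^{-t}XA^{1+t}\big)$$ is convex on $\mathbb{R}$, and its minimum is attained at $t=0$.
   Context: For a norm $N$ on $M_n(\mathbb{C})$ (the $n\times n$ complex matrices), the generalized numerical radius of $Y\in M_n(\mathbb{C})$ is $w_N(Y)=\sup_{\theta\in\mathbb{R}}N(\mathrm{Re}(e^{i\theta}Y))$, where $\mathrm{Re}(Z)=\frac12(Z+Z^* )$. The norm $N$ is unitarily invariant if $N(UYV)=N(Y)$ for all $Y\in M_n(\mathbb{C})$ and all unitary $U,V\in M_n(\mathbb{C})$. For a positive definite (Hermitian) matrix $A$ and $t\in\mathbb{R}$, $A^t$ is defined by the functional calculus. *)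

(* Defs.v *)
From mathcomp Require Import all_boot all_order all_algebra.
From mathcomp Require Import sesquilinear spectral.
From mathcomp Require Import complex.
From mathcomp Require Import all_classical all_reals all_analysis.

Set Implicit Arguments.
Unset Strict Implicit.
Unset Printing Implicit Defensive.
Import Order.TTheory GRing.Theory Num.Theory.

Local Open Scope classical_set_scope.
Local Open Scope ring_scope.
Local Open Scope complex_scope.
Local Open Scope sesquilinear_scope.

(* N takes values in R whereas `|c| : R[i], hence the real part. *)
Record mx_is_norm (R : realType) (n : nat) (N : 'M[R[i]]_n -> R) : Prop := {
  mx_is_norm_triangle : forall Y Z, N (Y + Z) <= N Y + N Z;
  mx_is_norm_scale : forall (c : R[i]) Y, N (c *: Y) = complex.Re `|c| * N Y;
  mx_is_norm_eq0 : forall Y, N Y = 0 -> Y = 0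
}.

Definition unitarily_invariant (R : realType) (n : nat)
    (N : 'M[R[i]]_n -> R) : Prop :=
  forall U Y V : 'M[R[i]]_n, U \is unitarymx -> V \is unitarymx ->
    N (U *m Y *m V) = N Y.

Definition mxRe (R : realType) (n : nat) (Z : 'M[R[i]]_n) : 'M[R[i]]_n :=
  2^-1 *: (Z + Z ^t*).

Definition gen_num_radius (R : realType) (n : nat) (N : 'M[R[i]]_n -> R)
    (Y : 'M[R[i]]_n) : R :=
  sup [set N (mxRe ((cos theta +i* sin theta) *: Y)) | theta in [set: R]].

(* In the order of R[i], 0 < z entails that z is real. *)
Definition posdefmx (R : realType) (n : nat) (A : 'M[R[i]]_n) : Prop :=
  A \is hermsymmx /\
  forall x : 'cV[R[i]]_n, x != 0 -> 0 < (x ^t* *m A *m x) 0 0.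

(* Functional calculus for a Hermitian A, through the spectral decomposition
   A = P^* D P with P := spectralmx A unitary and D the diagonal
   matrix of spectral_diag A. The eigenvalues are real, so Re only casts them;
   the value does not depend on the chosen decomposition. *)
Definition mxfun (R : realType) (n : nat) (f : R -> R) (A : 'M[R[i]]_n) :
    'M[R[i]]_n :=
  (spectralmx A) ^t* *m
  diag_mx (map_mx (fun z : R[i] => (f (complex.Re z))%:C) (spectral_diag A)) *m
  spectralmx A.

Definition mxpowR (R : realType) (n : nat) (A : 'M[R[i]]_n) (t : R) :
    'M[R[i]]_n :=
  mxfun (fun x => x `^ t) A.

(* Main.v *)
Require Import Defs.
From mathcomp Require Import all_boot all_order all_algebra.
From mathcomp Require Import perm sesquilinear spectral.
From mathcomp Require Import complex ring lra.
From mathcomp Require Import all_classical all_reals all_analysis.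

(* Put f t = A^t X A^(1-t) + A^-t X A^(1+t). The index law for the powers of A
   gives f (s + u) + f (s - u) = A^u f(s) A^-u + A^-u f(s) A^u, and taking real
   parts commutes with Y |-> S Y S^-1 + S^-1 Y S for Hermitian S. Midpoint
   convexity of k thus follows from 2 N(Y) <= N(S Y S^-1 + S^-1 Y S) for
   Hermitian Y (Corach, Porta and Recht), where the right-hand side is
   N(T + T^* ) for T = S Y S^-1, a matrix with the spectrum of Y: in a Schur
   basis of T the diagonal of T + T^* is twice that spectrum, and the norm of
   the diagonal part of a matrix is at most the norm of the matrix. Midpoint
   convexity and boundedness on segments give convexity, and k is even. *)

Set Implicit Arguments.
Unset Strict Implicit.
Unset Printing Implicit Defensive.
Import Order.TTheory GRing.Theory Num.Theory.

Local Open Scope classical_set_scope.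
Local Open Scope ring_scope.
Local Open Scope complex_scope.
Local Open Scope sesquilinear_scope.

Lemma char_poly_similar (F : fieldType) (n : nat) (P A B : 'M[F]_n) :
  P \in unitmx -> P *m A = B *m P -> char_poly A = char_poly B.
Proof.
move=> Pu PA; have detP : \det (map_mx (@polyC F) P) != 0.
  by rewrite det_map_mx polyC_eq0 -unitfE -unitmxE.
apply: (mulfI detP); rewrite -det_mulmx mulrC -det_mulmx; congr (\det _).
rewrite mulmxBr mulmxBl -!map_mxM PA; congr (_ - _).
by rewrite scalar_mxC.
Qed.

Lemma trig_char_poly_diag (F : fieldType) (n : nat) (M : 'M[F]_n)
    (d : 'rV[F]_n) :
  is_trig_mx M -> char_poly M = char_poly (diag_mx d) ->
  exists s : 'S_n, forall i, M i i = d 0 (s i).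
Proof.
move=> Mtrig; rewrite !char_poly_trig ?diag_mx_is_trig // => eqP.
have /tuple_permP[s sE] :
    perm_eq [tuple M i i | i < n] [tuple d 0 i | i < n].
  apply: prod_XsubC_eq; rewrite !big_map /= [LHS]eqP; apply: eq_bigr => i _.
  by rewrite mxE eqxx.
exists s => i; have := congr1 (fun t => tnth t i) (val_inj sE).
by rewrite !tnth_mktuple.
Qed.

Lemma adjmxM (C : numClosedFieldType) (m n p : nat) (A : 'M[C]_(m, n))
    (B : 'M[C]_(n, p)) : (A *m B) ^t* = B ^t* *m A ^t*.
Proof. by rewrite trmx_mul map_mxM. Qed.

Lemma adjmxD (C : numClosedFieldType) (m n : nat) (A B : 'M[C]_(m, n)) :
  (A + B) ^t* = A ^t* + B ^t*.
Proof. by rewrite raddfD map_mxD. Qed.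

Lemma hermsymmxP (C : numClosedFieldType) (n : nat) (A : 'M[C]_n) :
  reflect (A ^t* = A) (A \is hermsymmx).
Proof.
apply: (iffP (is_hermitianmxP _ _ _)); rewrite expr0 scale1r.
  by move=> {2}->.
by move=> {1}<-.
Qed.

Lemma perm_mx_unitary (C : numClosedFieldType) (n : nat) (s : 'S_n) :
  (perm_mx s : 'M[C]_n) \is unitarymx.
Proof.
by apply/unitarymxP; rewrite tr_perm_mx map_perm_mx -perm_mxM mulgV perm_mx1.
Qed.

Lemma unitary_trig (C : numClosedFieldType) (n : nat) (T : 'M[C]_n) :
  exists2 Q : 'M[C]_n, Q \is unitarymx & is_trig_mx (Q *m T *m Q ^t*).
Proof.
case: n T => [|n] T.
  by exists 1%:M; [apply/unitarymxP/matrixP; case|apply/is_trig_mxP; case].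
have [//|Q Qu] := @Schur _ _ T; rewrite /similar_to /= => QT.
by exists Q => //; rewrite -conjymx.
Qed.

Lemma mulmx_unitary_conj (C : numClosedFieldType) (n : nat)
    (P D E : 'M[C]_n) : P \is unitarymx ->
  (P ^t* *m D *m P) *m (P ^t* *m E *m P) = P ^t* *m (D *m E) *m P.
Proof. by move=> Pu; rewrite !mulmxA mulmxtVK. Qed.

Lemma adjmx_unitary_conj (C : numClosedFieldType) (n : nat) (P D : 'M[C]_n) :
  (P ^t* *m D *m P) ^t* = P ^t* *m D ^t* *m P.
Proof. by rewrite !adjmxM trmxCK mulmxA. Qed.

Lemma mulmx_unitary_conj_middle (C : numClosedFieldType) (n : nat)
    (P D X E : 'M[C]_n) :
  (P ^t* *m D *m P) *m X *m (P ^t* *m E *m P) =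
  P ^t* *m (D *m (P *m X *m P ^t*) *m E) *m P.
Proof. by rewrite !mulmxA. Qed.

Lemma sandwich_sandwich (K : pzRingType) (n : nat) (U S X T V : 'M[K]_n) :
  U *m (S *m X *m T) *m V = (U *m S) *m X *m (T *m V).
Proof. by rewrite !mulmxA. Qed.

Lemma sandwich_sumD (K : pzRingType) (n : nat) (U V Y Z : 'M[K]_n) :
  U *m (Y + Z) *m V + V *m (Y + Z) *m U =
  (U *m Y *m V + V *m Z *m U) + (V *m Y *m U + U *m Z *m V).
Proof. by rewrite !mulmxDr !mulmxDl addrACA [U *m Z *m V + _]addrC addrACA. Qed.

Lemma adjmx_sandwich (C : numClosedFieldType) (n : nat) (S X T : 'M[C]_n) :
  S ^t* = S -> T ^t* = T -> (S *m X *m T) ^t* = T *m X ^t* *m S.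
Proof. by move=> Sh Th; rewrite !adjmxM Sh Th mulmxA. Qed.

Section UnitarilyInvariantNorm.
Variables (R : realType) (n : nat) (N : 'M[R[i]]_n -> R).
Hypotheses (N_norm : mx_is_norm N) (N_uinv : unitarily_invariant N).

Lemma normZ_real (r : R) Y : N (r%:C *: Y) = `|r| * N Y.
Proof.
by rewrite (mx_is_norm_scale N_norm) normc_def /= expr0n addr0 sqrtr_sqr.
Qed.

Lemma norm_ge0 Y : 0 <= N Y.
Proof.
have N0 : N 0 = 0 by rewrite -(scale0r 0) -[0]/(0%:C) normZ_real normr0 mul0r.
have NN : N (- Y) = N Y.
  rewrite -scaleN1r -[-1](rmorphN1 (real_complex R)) normZ_real normrN1.
  by rewrite mul1r.
have := mx_is_norm_triangle N_norm Y (- Y); rewrite subrr N0 NN; lra.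
Qed.

Lemma norm_double Y : N (Y + Y) = N Y + N Y.
Proof.
have -> : Y + Y = (2%:R : R)%:C *: Y by rewrite rmorph_nat scaler_nat mulr2n.
by rewrite normZ_real ger0_norm // -mulr2n mulr_natl.
Qed.

Lemma norm_sum I (r : seq I) (P : pred I) (F : I -> 'M[R[i]]_n) :
  N (\sum_(i <- r | P i) F i) <= \sum_(i <- r | P i) N (F i).
Proof.
elim/big_ind2: _ => [|Y a Z b Ya Zb|//].
  by rewrite -(scale0r 0) -[0 *: _]/(0%:C *: _) normZ_real normr0 mul0r.
by rewrite (le_trans (mx_is_norm_triangle N_norm _ _)) // lerD.
Qed.

(* Averaging M with its conjugate by the diagonal unitary having a single
   entry -1, at index k, deletes the off-diagonal part of row and column k. *)
Lemma norm_pinching_seq (s : seq 'I_n) (M : 'M[R[i]]_n) :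
  N (\matrix_(i, j) (M i j *+ ((i == j) || ((i \notin s) && (j \notin s)))))
    <= N M.
Proof.
elim: s => [|k s IHs].
  by rewrite le_eqVlt (_ : \matrix_(i, j) _ = M) ?eqxx //;
     apply/matrixP => i j; rewrite mxE orbT mulr1n.
apply: le_trans IHs; set M' := (X in _ <= N X).
pose D : 'M[R[i]]_n := diag_mx (\row_j (-1) ^+ (j == k)).
have Dt : D ^t* = D.
  rewrite /D tr_diag_mx map_diag_mx; congr diag_mx.
  by apply/rowP => j; rewrite !mxE rmorph_sign.
have Du : D \is unitarymx.
  apply/unitarymxP; rewrite Dt mulmx_diag; apply/matrixP => i j.
  by rewrite !mxE -expr2 sqrr_sign.
set L := (X in N X <= _).
have -> : L = (2^-1 : R)%:C *: (M' + D *m M' *m D).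
  apply/matrixP => i j; rewrite mul_mx_diag mul_diag_mx !mxE !inE.
  have half (z : R[i]) : (2^-1 : R)%:C * (z + z) = z.
    rewrite -mulr2n -(mulr_natl z 2) mulrA fmorphV rmorph_nat.
    by rewrite mulVf ?mul1r ?pnatr_eq0.
  have [->|ij] := eqVneq i j.
    by rewrite /= !mulr1n mulrAC -expr2 sqrr_sign mul1r half.
  case: eqVneq => [ik|ik]; case: eqVneq => [jk|jk] //=.
  - by rewrite ik jk eqxx in ij.
  - by rewrite expr1 expr0 mulr1 mulN1r subrr mulr0.
  - by rewrite andbF expr1 expr0 mul1r mulrN1 subrr mulr0.
  - by rewrite expr0 mul1r mulr1 half.
rewrite normZ_real ger0_norm ?invr_ge0 //.
have := mx_is_norm_triangle N_norm M' (D *m M' *m D); rewrite N_uinv //; lra.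
Qed.

Lemma norm_pinching (M : 'M[R[i]]_n) : N (diag_mx (\row_i M i i)) <= N M.
Proof.
rewrite (le_trans _ (norm_pinching_seq (enum 'I_n) M)) // le_eqVlt.
apply/orP; left; apply/eqP; congr N; apply/matrixP => i j.
by rewrite !mxE !mem_enum orbF; case: eqVneq => [->|].
Qed.

(* In a Schur basis of T the diagonal of T + T^* is twice the spectrum. *)
Lemma norm_spectrum_le_real_part (T : 'M[R[i]]_n) (d : 'rV[R[i]]_n) :
  d \is a realmx -> char_poly T = char_poly (diag_mx d) ->
  N (diag_mx d) + N (diag_mx d) <= N (T + T ^t*).
Proof.
move=> d_real eqTd; have [Q Qu] := unitary_trig T.
set M := Q *m T *m Q ^t* => Mtrig.
have QQ : Q ^t* *m Q = 1%:M by rewrite -[LHS]mul1mx mulmxA mulmxKtV.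
have QTu : Q ^t* \is unitarymx by rewrite trmxC_unitary.
have eqMd : char_poly M = char_poly (diag_mx d).
  rewrite -eqTd; apply/esym/(@char_poly_similar _ _ Q).
    exact: unitarymx_unit.
  by rewrite /M mulmxKtV.
have [s sE] := trig_char_poly_diag Mtrig eqMd.
have -> : N (T + T ^t*) = N (M + M ^t*).
  rewrite -(N_uinv (T + T ^t*) Qu QTu) /M !adjmxM trmxCK.
  by rewrite mulmxDr mulmxDl !mulmxA.
apply: le_trans (norm_pinching _); rewrite -norm_double.
have su := perm_mx_unitary R[i] s.
rewrite -(N_uinv (diag_mx d + diag_mx d) su (_ : (perm_mx s)^t* \is unitarymx));
  last by rewrite trmxC_unitary.
clearbody M.
rewrite le_eqVlt; apply/orP; left; apply/eqP; congr N; apply/matrixP => i j.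
rewrite -row_permE tr_perm_mx map_perm_mx -col_permE !mxE sE.
rewrite (inj_eq perm_inj); case: eqVneq => [->|_];
  last by rewrite !mulr0n addr0.
by rewrite !mulr1n (CrealP (mxOverP d_real _ _)).
Qed.

(* S Y S^-1 has the spectrum of Y, and its adjoint is S^-1 Y S. *)
Lemma norm_Corach_Porta_Recht (S S' Y : 'M[R[i]]_n) :
  S ^t* = S -> S' ^t* = S' -> S *m S' = 1%:M -> Y ^t* = Y ->
  N Y + N Y <= N (S *m Y *m S' + S' *m Y *m S).
Proof.
move=> Sh S'h SS' Yh; have Yherm : Y \is hermsymmx by apply/hermsymmxP.
have Vu := spectral_unitarymx Y.
have /hermitian_normalmx/orthomx_spectralP := Yherm.
rewrite invmx_unitary //; set V := spectralmx Y in Vu *; move=> YE.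
have := hermitian_spectral_diag_real Yherm.
set d := spectral_diag Y in YE * => d_real.
clearbody V d.
have VTu : V ^t* \is unitarymx by rewrite trmxC_unitary.
have -> : N Y = N (diag_mx d) by rewrite YE (N_uinv _ VTu Vu).
have -> : S' *m Y *m S = (S *m Y *m S') ^t* by rewrite adjmx_sandwich ?Yh.
apply: (norm_spectrum_le_real_part d_real).
have [Su S'u] := mulmx1_unit SS'.
transitivity (char_poly Y).
  apply/esym/(char_poly_similar Su).
  by rewrite -[RHS]mulmxA (mulmx1C SS') mulmx1.
apply: (@char_poly_similar _ _ V); first exact: unitarymx_unit.
by rewrite YE !mulmxA (unitarymxP Vu) mul1mx.
Qed.

End UnitarilyInvariantNorm.

(* The supremum M over [0, 1] of the defect g between f and its chord satisfies
   M <= M / 2, since every point is the midpoint of an end of [0, 1], where g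
   vanishes, and another point of [0, 1]. *)
Lemma convex_of_midpoint (R : realType) (f : R -> R) :
  (forall s u, f s + f s <= f (s + u) + f (s - u)) ->
  (forall K, exists B, forall t, `|t| <= K -> f t <= B) ->
  convex_function [set: R^o] f.
Proof.
move=> f_mid f_bnd p x y _ _; rewrite !convRE.
pose g q := f (q * x + (1 - q) * y) - (q * f x + (1 - q) * f y).
suff g_le0 q : 0 <= q <= 1 -> g q <= 0.
  by rewrite -subr_le0; apply: g_le0; rewrite ge0 le1.
have [B0 fB] := f_bnd (`|x| + `|y|).
have g_bnd r : 0 <= r <= 1 -> g r <= `|B0| + `|f x| + `|f y|.
  move=> /andP[r0 r1]; rewrite /g.
  have : f (r * x + (1 - r) * y) <= B0.
    apply/fB/(le_trans (ler_normD _ _)); rewrite !normrM ger0_norm //.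
    by rewrite (ger0_norm (_ : 0 <= 1 - r)) ?subr_ge0 // lerD //
      ler_piMl // lerBlDr lerDl.
  have := ler_norm B0.
  have : - (r * f x) <= `|f x|.
    apply: le_trans (ler_norm _) _; rewrite normrN normrM ger0_norm //.
    by rewrite ler_piMl.
  have : - ((1 - r) * f y) <= `|f y|.
    apply: le_trans (ler_norm _) _; rewrite normrN normrM.
    rewrite ger0_norm ?subr_ge0 //.
    by rewrite ler_piMl // lerBlDr lerDl.
  lra.
have g0 : g 0 = 0 by rewrite /g !mul0r !add0r subr0 !mul1r subrr.
have g1 : g 1 = 0 by rewrite /g subrr !mul0r !addr0 !mul1r subrr.
have g_mid r v : g r + g r <= g (r + v) + g (r - v).
  have := f_mid (r * x + (1 - r) * y) (v * (x - y)); rewrite /g.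
  rewrite (_ : r * x + (1 - r) * y + v * (x - y) =
    (r + v) * x + (1 - (r + v)) * y); last by ring.
  rewrite (_ : r * x + (1 - r) * y - v * (x - y) =
    (r - v) * x + (1 - (r - v)) * y); last by ring.
  lra.
pose E := g @` [set r | 0 <= r <= 1].
have E_ub : has_ubound E.
  by exists (`|B0| + `|f x| + `|f y|) => _ [r r01 <-]; exact: g_bnd.
have E_sup r : 0 <= r <= 1 -> g r <= sup E.
  by move=> r01; apply: ub_le_sup => //; exists r.
have E_half : ubound E (sup E / 2).
  move=> _ [r /= /andP[r0 r1] <-]; have [r_le|r_ge] := leP r 2^-1.
    have := g_mid r r; rewrite subrr g0.
    have : g (r + r) <= sup E by apply: E_sup; apply/andP; split; lra.
    lra.
  have := g_mid r (1 - r); rewrite subrKC g1.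
  have : g (r - (1 - r)) <= sup E by apply: E_sup; apply/andP; split; lra.
  lra.
have E0 : E 0 by exists 0; rewrite //= lexx ler01.
have := ge_sup (ex_intro _ _ E0) E_half.
by move=> supE /E_sup gq; lra.
Qed.

Section PowR.
Variables (R : realType) (n : nat) (A : 'M[R[i]]_n).

Lemma adj_mxpowR t : (mxpowR A t)^t* = mxpowR A t.
Proof.
rewrite /mxpowR /mxfun adjmx_unitary_conj tr_diag_mx map_diag_mx.
congr (_ *m diag_mx _ *m _).
by apply/rowP => i; rewrite !mxE; exact: conjc_real.
Qed.

Hypothesis A_posdef : posdefmx A.

Lemma posdef_spectral_diag_neq0 i : complex.Re (spectral_diag A 0 i) != 0.
Proof.
have [Aherm Apos] := A_posdef; have Pu := spectral_unitarymx A.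
have := orthomx_spectralP (hermitian_normalmx Aherm).
rewrite invmx_unitary // => AE; set P := spectralmx A in Pu AE.
set d := spectral_diag A in AE *.
pose x : 'cV[R[i]]_n := P ^t* *m delta_mx i 0.
have xx : (x ^t* *m A *m x) 0 0 = d 0 i.
  rewrite AE /x adjmxM trmxCK !mulmxA mulmxtVK // mulmxtVK // mul_mx_diag.
  rewrite mxE (bigD1 i) //= !mxE !eqxx big1 ?addr0 /=.
    by rewrite rmorph1 mulr1 mul1r.
  by move=> j ji; rewrite !mxE (negPf ji) /= mulr0.
have := Apos x; rewrite xx => dpos.
suff /dpos : x != 0.
  by rewrite ltcE => /andP[_]; exact: lt0r_neq0.
apply/negP => /eqP /(congr1 (mulmx P)); rewrite mulmxA (unitarymxP Pu) mulmx0.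
rewrite mul1mx => /matrixP/(_ i 0); rewrite !mxE !eqxx /= => /eqP.
by rewrite oner_eq0.
Qed.

Lemma mxpowRD s t : mxpowR A (s + t) = mxpowR A s *m mxpowR A t.
Proof.
apply: etrans (esym (mulmx_unitary_conj _ _ (spectral_unitarymx A))).
congr (_ *m _ *m _); rewrite mulmx_diag; congr diag_mx.
apply/rowP => i; rewrite !mxE -rmorphM powRD //.
by rewrite posdef_spectral_diag_neq0 implybT.
Qed.

Lemma mxpowR0 : mxpowR A 0 = 1%:M.
Proof.
have Pu := spectral_unitarymx A.
rewrite /mxpowR /mxfun (_ : diag_mx _ = 1%:M) ?mulmx1.
  by rewrite -[LHS]mul1mx mulmxA mulmxKtV.
by apply/matrixP => i j; rewrite !mxE powRr0.
Qed.

End PowR.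

Lemma powR_le_expR (R : realType) (x a K : R) :
  `|a| <= K -> x `^ a <= expR (K * `|ln x|).
Proof.
move=> aK; rewrite /powR; case: ifP => _.
  apply: (@le_trans _ _ 1); first by case: (a == 0).
  by rewrite -expR0 ler_expR mulr_ge0 // (le_trans _ aK).
by rewrite ler_expR (le_trans (ler_norm _)) // normrM ler_wpM2r.
Qed.

Lemma mxReD (R : realType) (n : nat) (Y Z : 'M[R[i]]_n) :
  mxRe (Y + Z) = mxRe Y + mxRe Z.
Proof. by rewrite /mxRe adjmxD addrACA scalerDr. Qed.

Lemma adj_mxRe (R : realType) (n : nat) (Y : 'M[R[i]]_n) :
  (mxRe Y) ^t* = mxRe Y.
Proof.
rewrite /mxRe linearZ /= map_mxZ adjmxD trmxCK addrC; congr (_ *: _).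
by rewrite fmorphV rmorph_nat.
Qed.

Lemma mxRe_sandwich (R : realType) (n : nat) (S T Y : 'M[R[i]]_n) :
  S ^t* = S -> T ^t* = T ->
  mxRe (S *m Y *m T + T *m Y *m S) = S *m mxRe Y *m T + T *m mxRe Y *m S.
Proof.
move=> Sh Th; rewrite /mxRe adjmxD !adjmxM Sh Th.
rewrite -!scalemxAr -!scalemxAl -scalerDr; congr (_ *: _).
by rewrite !mulmxDr !mulmxDl !mulmxA -!addrA; congr (_ + _);
  rewrite addrA addrC.
Qed.

Section NumericalRadius.
Variables (R : realType) (n : nat) (N : 'M[R[i]]_n -> R).
Hypotheses (N_norm : mx_is_norm N) (N_uinv : unitarily_invariant N).

Lemma norm_rotation theta Y : N ((cos theta +i* sin theta) *: Y) = N Y.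
Proof.
by rewrite (mx_is_norm_scale N_norm) normc_def /= cos2Dsin2 sqrtr1 mul1r.
Qed.

Lemma norm_mxRe_rotation_le theta Y :
  N (mxRe ((cos theta +i* sin theta) *: Y)) <= N Y + N (Y ^t*).
Proof.
rewrite /mxRe (_ : 2^-1 = (2^-1 : R)%:C); last by rewrite fmorphV rmorph_nat.
have -> : ((cos theta +i* sin theta) *: Y) ^t* =
    (cos (- theta) +i* sin (- theta)) *: Y ^t*.
  by apply/matrixP => i j; rewrite !mxE rmorphM cosN sinN.
rewrite normZ_real //.
rewrite ger0_norm ?invr_ge0 //.
have := mx_is_norm_triangle N_norm ((cos theta +i* sin theta) *: Y)
  ((cos (- theta) +i* sin (- theta)) *: Y ^t*).
rewrite !norm_rotation.
have := norm_ge0 N_norm Y; have := norm_ge0 N_norm (Y ^t*); lra.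
Qed.

Lemma norm_mxRe_rotation_le_radius theta Y :
  N (mxRe ((cos theta +i* sin theta) *: Y)) <= gen_num_radius N Y.
Proof.
apply: ub_le_sup; last by exists theta.
by exists (N Y + N (Y ^t*)) => _ [t _ <-]; exact: norm_mxRe_rotation_le.
Qed.

Lemma gen_num_radius_le Y B :
  (forall theta, N (mxRe ((cos theta +i* sin theta) *: Y)) <= B) ->
  gen_num_radius N Y <= B.
Proof.
move=> YB; apply: ge_sup; last by move=> _ [t _ <-].
by exists (N (mxRe ((cos 0 +i* sin 0) *: Y))), 0.
Qed.

Lemma gen_num_radiusD Y Z :
  gen_num_radius N (Y + Z) <= gen_num_radius N Y + gen_num_radius N Z.
Proof.
apply: gen_num_radius_le => theta; rewrite scalerDr mxReD.
apply: le_trans (mx_is_norm_triangle N_norm _ _) _.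
by rewrite lerD // norm_mxRe_rotation_le_radius.
Qed.

Lemma gen_num_radius_Corach_Porta_Recht (S S' Y : 'M[R[i]]_n) :
  S ^t* = S -> S' ^t* = S' -> S *m S' = 1%:M ->
  gen_num_radius N Y + gen_num_radius N Y
    <= gen_num_radius N (S *m Y *m S' + S' *m Y *m S).
Proof.
move=> Sh S'h SS'; set w := (X in _ <= X).
suff : gen_num_radius N Y <= w / 2 by lra.
apply: gen_num_radius_le => theta; set c := _ +i* _.
have := norm_Corach_Porta_Recht N_norm N_uinv Sh S'h SS' (adj_mxRe (c *: Y)).
rewrite -mxRe_sandwich // -!scalemxAr -!scalemxAl -scalerDr.
have : N (mxRe (c *: (S *m Y *m S' + S' *m Y *m S))) <= w.
  exact: norm_mxRe_rotation_le_radius.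
lra.
Qed.

Variable A : 'M[R[i]]_n.

Lemma norm_mxpowR_bounded (X : 'M[R[i]]_n) (K : R) :
  exists B, forall a b, `|a| <= K -> `|b| <= K ->
    N (mxpowR A a *m X *m mxpowR A b) <= B.
Proof.
have Pu := spectral_unitarymx A; set P := spectralmx A in Pu.
pose Z := P *m X *m P ^t*.
pose e i := expR (K * `|ln (complex.Re (spectral_diag A 0 i))|).
exists (\sum_i \sum_j e i * e j * N (Z i j *: delta_mx i j)) => a b aK bK.
pose D t : 'M[R[i]]_n :=
  diag_mx (map_mx (fun z : R[i] => (complex.Re z `^ t)%:C) (spectral_diag A)).
have -> : mxpowR A a *m X *m mxpowR A b = P ^t* *m (D a *m Z *m D b) *m P.
  exact: mulmx_unitary_conj_middle.
rewrite N_uinv ?trmxC_unitary // [D a *m Z *m D b]matrix_sum_delta.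
apply: le_trans (norm_sum N_norm _ _ _) _; apply: ler_sum => i _.
apply: le_trans (norm_sum N_norm _ _ _) _; apply: ler_sum => j _.
rewrite mul_mx_diag mul_diag_mx !mxE mulrAC -rmorphM -scalerA normZ_real //.
rewrite ler_wpM2r ?norm_ge0 // ger0_norm ?mulr_ge0 ?powR_ge0 //.
by rewrite ler_pM ?powR_ge0 // powR_le_expR.
Qed.

End NumericalRadius.

Lemma gen_num_radius_heinz_convex (R : realType) (n : nat)
    (N : 'M[R[i]]_n -> R) (N_norm : mx_is_norm N)
    (N_uinv : unitarily_invariant N)
    (pw : R -> 'M[R[i]]_n) (X : 'M[R[i]]_n) :
  pw 0 = 1%:M -> (forall s t, pw (s + t) = pw s *m pw t) ->
  (forall t, (pw t) ^t* = pw t) ->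
  (forall Y K, exists B, forall a b, `|a| <= K -> `|b| <= K ->
     N (pw a *m Y *m pw b) <= B) ->
  let k (t : R) : R :=
    gen_num_radius N (pw t *m X *m pw (1 - t) + pw (- t) *m X *m pw (1 + t)) in
  convex_function [set: R^o] k /\ (forall t : R, k 0 <= k t).
Proof.
move=> pw0 pwD adj_pw pw_bounded.
pose T a b := pw a *m X *m pw b.
pose f t := T t (1 - t) + T (- t) (1 + t).
move=> k; have kE t : k t = gen_num_radius N (f t) by [].
clearbody k.
have T_sandwich u v a b :
    pw u *m T a b *m pw v = T (u + a) (b + v).
  by rewrite /T sandwich_sandwich -!pwD.
have T_eq a b a' b' : a = a' -> b = b' -> T a b = T a' b' by move=> -> ->.
have k_mid s u : k s + k s <= k (s + u) + k (s - u).
  rewrite !kE.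
  have inv_u : pw u *m pw (- u) = 1%:M.
    by rewrite -pwD subrr pw0.
  apply: le_trans (gen_num_radius_Corach_Porta_Recht N_norm N_uinv (f s)
    (adj_pw u) (adj_pw (- u)) inv_u) _.
  have -> : pw u *m f s *m pw (- u)
      + pw (- u) *m f s *m pw u = f (s + u) + f (s - u).
    rewrite /f sandwich_sumD !T_sandwich.
    by apply: congr2; apply: congr2; apply: T_eq; ring.
  exact: gen_num_radiusD.
split; last first.
  move=> t; have := k_mid 0 t; rewrite add0r sub0r.
  have -> : k (- t) = k t by rewrite !kE /f opprK addrC.
  lra.
apply: convex_of_midpoint => // K.
have [B1 T_le] := pw_bounded X (K + 1).
have [B2 T_adj_le] := pw_bounded (X ^t*) (K + 1).
exists (B1 + B1 + (B2 + B2)) => t tK.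
have t1 : `|t| <= K + 1 by lra.
have t2 : `|- t| <= K + 1 by rewrite normrN.
have t3 : `|1 - t| <= K + 1.
  by rewrite (le_trans (ler_normB _ _)) // normr1 addrC lerD2r.
have t4 : `|1 + t| <= K + 1.
  by rewrite (le_trans (ler_normD _ _)) // normr1 addrC lerD2r.
rewrite kE; apply: gen_num_radius_le => theta.
apply: le_trans (norm_mxRe_rotation_le N_norm _ _) _.
have fB : N (f t) <= B1 + B1.
  by apply: le_trans (mx_is_norm_triangle N_norm _ _) _; rewrite lerD // T_le.
have fadjB : N ((f t) ^t*) <= B2 + B2.
  rewrite /f adjmxD (adjmx_sandwich _ (adj_pw t) (adj_pw _)).
  rewrite (adjmx_sandwich _ (adj_pw (- t)) (adj_pw _)).
  by apply: le_trans (mx_is_norm_triangle N_norm _ _) _;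
     rewrite lerD // T_adj_le.
exact: lerD.
Qed.

Theorem mainTheorem8 (R : realType) (n : nat) (N : 'M[R[i]]_n -> R)
    (N_norm : mx_is_norm N) (N_uinv : unitarily_invariant N)
    (A X : 'M[R[i]]_n) (A_posdef : posdefmx A) :
  let k (t : R) : R :=
    gen_num_radius N (mxpowR A t *m X *m mxpowR A (1 - t)
                      + mxpowR A (- t) *m X *m mxpowR A (1 + t)) in
  convex_function [set: R^o] k /\ (forall t : R, k 0 <= k t).
Proof.
apply: gen_num_radius_heinz_convex => //.
- exact: mxpowR0.
- exact: mxpowRD.
- exact: adj_mxpowR.
- exact: norm_mxpowR_bounded.
Qed.
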